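(* Let $n>1$ be an integer. The set $\{N\in\mathcal{G}_n : \mathbb{F}_n/N \text{ has decidable word problem}\}$, i.e. the set of $N\in\mathcal{G}_n$ that are recursive subsets of $\mathbb{F}_n$, is $\mathbf{\Sigma}^0_2$-complete.
   Context: $\mathbb{F}_n$ is the free group on $\gamma_1,\dots,\gamma_n$ (elements viewed as reduced words, so recursiveness of subsets makes sense). $\mathcal{G}_n$ denotes the set of normal subgroups $N\trianglelefteq\mathbb{F}_n$, viewed as a subset of $\{0,1\}^{\mathbb{F}_n}$ with the subspace topology of the product of discrete topologies; it is a compact zero-dimensional Polish space. The marked group $\mathbb{F}_n/N$ (generators $\gamma_iN$) has decidable word problem iff $N$ is a recursive set. Borel classes: $\mathbf{\Sigma}^0_1$ = open sets, $\mathbf{\Pi}^0_\alpha$ = complements of $\mathbf{\Sigma}^0_\alpha$ sets, $\mathbf{\Sigma}^0_\alpha$ ($\alpha>1$) = countable unions of sets in $\bigcup_{\beta<\alpha}\mathbf{\Pi}^0_\beta$. For $\mathbf{\Gamma}$ one of these classes, $A\subseteq X$ is $\mathbf{\Gamma}$-complete if $A\in\mathbf{\Gamma}$ and for every zero-dimensional Polish space $Y$ and every $B\subseteq Y$ in $\mathbf{\Gamma}$ there is a continuous $f:Y\to X$ with $f^{-1}[A]=B$. *)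

(* Defs.v *)
From Stdlib Require Import Reals List Arith Bool.
Import ListNotations.
Open Scope R_scope.

(* Free group F_n on generators gamma_1..gamma_n (letters 0..n-1).      *)
(* A letter (i, true) is gamma_{i+1}, (i, false) is its inverse.       *)
(* Elements of F_n are reduced words.                                  *)
Definition letter : Type := (nat * bool)%type.
Definition word : Type := list letter.

Definition cancels (x y : letter) : bool :=
  Nat.eqb (fst x) (fst y) && negb (Bool.eqb (snd x) (snd y)).

Fixpoint reduce (w : word) : word :=
  match w with
  | [] => []
  | x :: w' =>
      match reduce w' with
      | y :: r => if cancels x y then r else x :: y :: r
      | [] => [x]
      end
  end.

Definition in_Fn (n : nat) (w : word) : Prop :=
  reduce w = w /\ Forall (fun x => (fst x < n)%nat) w.

Definition fmul (u v : word) : word := reduce (u ++ v).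
Definition finv (w : word) : word := rev (map (fun x => (fst x, negb (snd x))) w).

Definition is_normal_subgroup (n : nat) (N : word -> Prop) : Prop :=
  (forall w, N w -> in_Fn n w) /\
  N [] /\
  (forall u v, N u -> N v -> N (fmul u v)) /\
  (forall u, N u -> N (finv u)) /\
  (forall g u, in_Fn n g -> N u -> N (fmul (fmul g u) (finv g))).

Inductive code : Type :=
| CZero
| CSucc
| CProj (i : nat)
| CComp (f : code) (gs : list code)
| CPrec (f g : code)
| CMu (f : code).

Fixpoint omap_all {A B : Type} (h : A -> option B) (l : list A) : option (list B) :=
  match l with
  | [] => Some []
  | a :: l' =>
      match h a, omap_all h l' with
      | Some b, Some bs => Some (b :: bs)
      | _, _ => None
      end
  end.

Fixpoint eval (k : nat) (c : code) (args : list nat) {struct k} : option nat :=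
  match k with
  | O => None
  | S k' =>
      match c with
      | CZero => Some O
      | CSucc => Some (S (hd O args))
      | CProj i => Some (nth i args O)
      | CComp f gs =>
          match omap_all (fun g => eval k' g args) gs with
          | Some vs => eval k' f vs
          | None => None
          end
      | CPrec f g =>
          match args with
          | [] => None
          | x :: rest =>
              (fix pr (m : nat) : option nat :=
                 match m with
                 | O => eval k' f rest
                 | S m' =>
                     match pr m' with
                     | Some r => eval k' g (m' :: r :: rest)
                     | None => None
                     end
                 end) x
          end
      | CMu f =>
          (fix search (b : nat) (y : nat) : option nat :=
             match b with
             | O => None
             | S b' =>
                 match eval k' f (y :: args) with
                 | Some O => Some y
                 | Some _ => search b' (S y)
                 | None => None
                 end
             end) k' O
      end
  end.

Definition halts_with (c : code) (x : nat) (v : nat) : Prop :=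
  exists k, eval k c [x] = Some v.

Definition cantor_pair (a b : nat) : nat := ((a + b) * (a + b + 1) / 2 + b)%nat.
Definition encode_letter (x : letter) : nat :=
  (2 * fst x + (if snd x then 1 else 0))%nat.
Fixpoint encode_word (w : word) : nat :=
  match w with
  | [] => O
  | x :: w' => S (cantor_pair (encode_letter x) (encode_word w'))
  end.

Definition recursive_subset (n : nat) (N : word -> Prop) : Prop :=
  exists c : code, forall w, in_Fn n w ->
    (N w -> halts_with c (encode_word w) 1) /\
    (~ N w -> halts_with c (encode_word w) 0).

(* Generic (relative) topology notions: a carrier predicate S on a type *)
(* X and a family `op` of open sets (relative to S).                   *)
Definition closed_in {X : Type} (S : X -> Prop) (op : (X -> Prop) -> Prop)
  (C : X -> Prop) : Prop :=
  (forall x, C x -> S x) /\ op (fun x => S x /\ ~ C x).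

Definition Sigma02 {X : Type} (S : X -> Prop) (op : (X -> Prop) -> Prop)
  (A : X -> Prop) : Prop :=
  exists F : nat -> X -> Prop,
    (forall k, closed_in S op (F k)) /\ (forall x, A x <-> exists k, F k x).

Definition continuous_between {X Y : Type}
  (SX : X -> Prop) (opX : (X -> Prop) -> Prop)
  (SY : Y -> Prop) (opY : (Y -> Prop) -> Prop) (f : X -> Y) : Prop :=
  (forall x, SX x -> SY (f x)) /\
  (forall U, opY U -> opX (fun x => SX x /\ U (f x))).

(* The topology of G_n: subspace of {0,1}^{F_n} with the product of
   discrete topologies (basic opens fix finitely many coordinates). *)
Definition Gn (n : nat) : (word -> Prop) -> Prop := is_normal_subgroup n.

Definition Gn_open (n : nat) (U : (word -> Prop) -> Prop) : Prop :=
  forall N, Gn n N -> U N ->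
    exists s : list word, forall N', Gn n N' ->
      (forall w, In w s -> (N w <-> N' w)) -> U N'.

(* Metric spaces; zero-dimensional Polish spaces are exactly the       *)
(* spaces carrying a complete separable metric with a clopen basis.    *)
Definition is_metric {Y : Type} (d : Y -> Y -> R) : Prop :=
  (forall x y, 0 <= d x y) /\
  (forall x y, d x y = 0 <-> x = y) /\
  (forall x y, d x y = d y x) /\
  (forall x y z, d x z <= d x y + d y z).

Definition metric_open {Y : Type} (d : Y -> Y -> R) (U : Y -> Prop) : Prop :=
  forall x, U x -> exists eps, 0 < eps /\ forall y, d x y < eps -> U y.

Definition metric_complete {Y : Type} (d : Y -> Y -> R) : Prop :=
  forall u : nat -> Y,
    (forall eps, 0 < eps -> exists N, forall m k, (N <= m)%nat -> (N <= k)%nat ->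
        d (u m) (u k) < eps) ->
    exists l, forall eps, 0 < eps -> exists N, forall m, (N <= m)%nat -> d (u m) l < eps.

Definition metric_separable {Y : Type} (d : Y -> Y -> R) : Prop :=
  (forall x : Y, False) \/
  exists D : nat -> Y, forall x eps, 0 < eps -> exists k, d x (D k) < eps.

Definition metric_zero_dim {Y : Type} (d : Y -> Y -> R) : Prop :=
  forall x eps, 0 < eps -> exists U : Y -> Prop,
    metric_open d U /\ metric_open d (fun y => ~ U y) /\ U x /\
    (forall y, U y -> d x y < eps).

Definition zero_dim_polish {Y : Type} (d : Y -> Y -> R) : Prop :=
  is_metric d /\ metric_complete d /\ metric_separable d /\ metric_zero_dim d.

Definition Sigma02_complete_in_Gn (n : nat) (A : (word -> Prop) -> Prop) : Prop :=
  (forall N, A N -> Gn n N) /\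
  Sigma02 (Gn n) (Gn_open n) A /\
  (forall (Y : Type) (d : Y -> Y -> R), zero_dim_polish d ->
     forall B : Y -> Prop, Sigma02 (fun _ => True) (metric_open d) B ->
     exists f : Y -> (word -> Prop),
       continuous_between (fun _ => True) (metric_open d) (Gn n) (Gn_open n) f /\
       (forall y, A (f y) <-> B y)).

(* Main.v *)
(** The group is Z acting by translation on an extension, by central involutions z_p
    (p > 0), of the finite subsets of Z, the commutator of the lamps at i and j being
    z_|i-j|. It is generated by the translation and the lamp at 0, and every set X of
    positive integers gives a normal subgroup N(X) of F_n, the kernel of the map onto
    its quotient by the z_p with p in X. Whether a word lies in N(X) depends on the
    p in X up to its length only, so N(X) depends continuously on X, and N(X) is
    recursive when X is finite.

    Given a union of closed sets F_k, follow a point y by a pointer k that moves on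
    once y is seen to be outside F_k. Each move puts one integer in X(y) or leaves it out, so
    that the k-th code does not decide N(X(y)). If y is in the union, there are
    finitely many moves and N(X(y)) is recursive; otherwise every code is defeated. *)

Require Import Defs.
From Stdlib Require Import Reals List Arith Bool ZArith Lia Lra.
From Stdlib Require Import Classical ClassicalEpsilon ChoiceFacts.
Import ListNotations.
Local Open Scope nat_scope.

(** * Total computable functions *)

(** Success is asked for all large amounts of fuel, so that the bounds of several subcomputations
    can simply be added. *)
Definition evaluates (c : code) (args : list nat) (v : nat) : Prop :=
  exists K, forall k, K <= k -> eval k c args = Some v.

Definition computable (n : nat) (f : list nat -> nat) : Prop :=
  exists c, forall e, length e = n -> evaluates c e (f e).

Lemma computable_ext n f g :
  (forall e, length e = n -> f e = g e) -> computable n f -> computable n g.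
Proof.
  intros H [c Hc]. exists c. intros e He. rewrite <- (H e He). auto.
Qed.

Lemma computable_zero n : computable n (fun _ => 0).
Proof.
  exists CZero. intros e _. exists 1. intros [|k] Hk; [lia|reflexivity].
Qed.

Lemma computable_proj n i : computable n (fun e => nth i e 0).
Proof.
  exists (CProj i). intros e _. exists 1. intros [|k] Hk; [lia|reflexivity].
Qed.

Lemma omap_all_evaluates (e : list nat) cs vs :
  Forall2 (fun c v => evaluates c e v) cs vs ->
  exists K, forall k, K <= k -> omap_all (fun c => eval k c e) cs = Some vs.
Proof.
  induction 1 as [|c v cs vs [K1 H1] _ [K2 H2]].
  - exists 0. reflexivity.
  - exists (K1 + K2). intros k Hk. simpl.
    rewrite H1, H2 by lia. reflexivity.
Qed.

Lemma evaluates_comp f cs e vs v :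
  Forall2 (fun c u => evaluates c e u) cs vs -> evaluates f vs v ->
  evaluates (CComp f cs) e v.
Proof.
  intros H1 [K2 H2]. destruct (omap_all_evaluates _ _ _ H1) as [K1 HK1].
  exists (S (K1 + K2)). intros [|k] Hk; [lia|]. simpl.
  rewrite HK1 by lia. apply H2. lia.
Qed.

Lemma computable_comp n f gs :
  computable (length gs) f -> Forall (computable n) gs ->
  computable n (fun e => f (map (fun g => g e) gs)).
Proof.
  intros [cf Hf] Hgs.
  assert (exists cs, Forall2
    (fun c (g : list nat -> nat) => forall e, length e = n -> evaluates c e (g e))
    cs gs) as [cs Hcs].
  { clear Hf. induction Hgs as [|g gs [c Hc] _ [cs IH]].
    - exists []. constructor.
    - exists (c :: cs). constructor; assumption. }
  exists (CComp cf cs). intros e He.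
  apply evaluates_comp with (vs := map (fun g => g e) gs).
  - clear Hf Hgs. induction Hcs; simpl; constructor; auto.
  - apply Hf. apply length_map.
Qed.

Lemma computable_subst n f l :
  computable (length l) f ->
  computable n (fun e => f (map (fun i => nth i e 0) l)).
Proof.
  intros Hf.
  apply computable_ext with
    (fun e => f (map (fun g => g e) (map (fun i (e : list nat) => nth i e 0) l))).
  - intros e _. rewrite map_map. reflexivity.
  - apply computable_comp.
    + rewrite length_map. exact Hf.
    + apply Forall_map. apply Forall_forall. intros i _. apply computable_proj.
Qed.

Lemma map_nth_seq (e l : list nat) :
  map (fun i => nth i (l ++ e) 0) (seq (length l) (length e)) = e.
Proof.
  revert l. induction e as [|x e IH]; intros l; simpl; [reflexivity|].
  rewrite nth_middle. f_equal.
  specialize (IH (l ++ [x])). rewrite length_app in IH. simpl in IH.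
  rewrite Nat.add_1_r, <- app_assoc in IH. exact IH.
Qed.

Lemma computable_tl n f :
  computable n f -> computable (S n) (fun e => f (tl e)).
Proof.
  intros Hf.
  apply computable_ext with (fun e => f (map (fun i => nth i e 0) (seq 1 n))).
  - intros [|x e] He; [discriminate|]. injection He as <-.
    exact (f_equal f (map_nth_seq e [x])).
  - apply computable_subst. rewrite length_seq. exact Hf.
Qed.

(** [CPrec] recurses on its first argument. Composing it with [h] and the projections computes the
    bound from [e] and keeps [e] as the parameters. *)
Lemma computable_rec n f g h :
  computable n f -> computable (S (S n)) g -> computable n h ->
  computable n
    (fun e => nat_rect (fun _ => nat) (f e) (fun m r => g (m :: r :: e)) (h e)).
Proof.
  intros [cf Hf] [cg Hg] [ch Hh].
  exists (CComp (CPrec cf cg) (ch :: map CProj (seq 0 n))). intros e He.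
  apply evaluates_comp with (vs := h e :: e).
  - constructor; [auto|].
    assert (E : Forall2 (fun c u => evaluates c e u) (map CProj (seq 0 n))
      (map (fun i => nth i e 0) (seq 0 n))).
    { induction (seq 0 n) as [|i l IH]; simpl; constructor; [|exact IH].
      exists 1. intros [|k] Hk; [lia|reflexivity]. }
    rewrite <- He in *. pose proof (map_nth_seq e []) as E'. simpl in E'.
    rewrite E' in E. exact E.
  (* At fuel [S k] the goal unfolds to the inner fixpoint of [eval], whose steps all run at fuel
     [k]; hence a plain induction on the recursion argument. *)
  - assert (H : exists K, forall k, K <= k -> eval (S k) (CPrec cf cg) (h e :: e)
      = Some (nat_rect (fun _ => nat) (f e) (fun m r => g (m :: r :: e)) (h e))).
    { induction (h e) as [|m [K1 H1]].
      - destruct (Hf e He) as [K HK]. exists K. intros k Hk. apply HK. exact Hk.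
      - destruct (Hg (m :: nat_rect (fun _ => nat) (f e)
          (fun m r => g (m :: r :: e)) m :: e)) as [K2 H2];
          [simpl; congruence|].
        exists (K1 + K2). intros k Hk.
        specialize (H1 k ltac:(lia)). simpl in H1 |- *. rewrite H1.
        apply H2. lia. }
    destruct H as [K HK]. exists (S K). intros [|k] Hk; [lia|]. apply HK. lia.
Qed.

Lemma computable_succ n f : computable n f -> computable n (fun e => S (f e)).
Proof.
  intros Hf. apply (computable_comp n (fun e => S (hd 0 e)) [f]).
  - exists CSucc. intros e _. exists 1. intros [|k] Hk; [lia|reflexivity].
  - repeat constructor. exact Hf.
Qed.

Lemma computable_const n a : computable n (fun _ => a).
Proof.
  induction a as [|a IH]; [apply computable_zero|].
  exact (computable_succ _ _ IH).
Qed.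

Lemma computable_add n f g :
  computable n f -> computable n g -> computable n (fun e => f e + g e).
Proof.
  intros Hf Hg. eapply computable_ext;
    [|apply (computable_rec n f (fun e => S (nth 1 e 0)) g Hf);
      [apply computable_succ, computable_proj|exact Hg]].
  intros e _. cbn beta. induction (g e) as [|m IH]; simpl in *; lia.
Qed.

Lemma computable_mul n f g :
  computable n f -> computable n g -> computable n (fun e => f e * g e).
Proof.
  intros Hf Hg. eapply computable_ext;
    [|apply (computable_rec n (fun _ => 0)
        (fun e => nth 1 e 0 + f (tl (tl e))) g (computable_zero n));
      [apply computable_add;
        [apply computable_proj|apply (computable_tl _ (fun e => f (tl e))), computable_tl, Hf]
      |exact Hg]].
  intros e _. cbn beta. induction (g e) as [|m IH]; simpl in *; lia.
Qed.

Lemma computable_pred n f : computable n f -> computable n (fun e => pred (f e)).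
Proof.
  intros Hf. eapply computable_ext;
    [|apply (computable_rec n (fun _ => 0) (fun e => nth 0 e 0) f
        (computable_zero n)); [apply computable_proj|exact Hf]].
  intros e _. cbn beta. destruct (f e); reflexivity.
Qed.

Lemma computable_sub n f g :
  computable n f -> computable n g -> computable n (fun e => f e - g e).
Proof.
  intros Hf Hg. eapply computable_ext;
    [|apply (computable_rec n f (fun e => pred (nth 1 e 0)) g Hf);
      [apply computable_pred, computable_proj|exact Hg]].
  intros e _. cbn beta. induction (g e) as [|m IH]; simpl in *; lia.
Qed.

Definition eqn (a b : nat) : nat := if a =? b then 1 else 0.

Lemma computable_eqn n f g :
  computable n f -> computable n g -> computable n (fun e => eqn (f e) (g e)).
Proof.
  intros Hf Hg.
  apply computable_ext with (fun e => 1 - ((f e - g e) + (g e - f e))).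
  - intros e _. unfold eqn. destruct (Nat.eqb_spec (f e) (g e)); lia.
  - apply computable_sub; [apply computable_const|].
    apply computable_add; apply computable_sub; assumption.
Qed.

(** Written with [nat_rect], like [bsum] and [drop_code] below, so that [computable_rec] applies by
    conversion. *)
Definition par (z : nat) : nat := nat_rect (fun _ => nat) 0 (fun _ r => 1 - r) z.

Lemma par_odd z : par z = Nat.b2n (Nat.odd z).
Proof.
  induction z as [|z IH]; [reflexivity|].
  rewrite Nat.odd_succ, <- Nat.negb_odd.
  change (1 - par z = Nat.b2n (negb (Nat.odd z))). rewrite IH.
  destruct (Nat.odd z); reflexivity.
Qed.

Lemma computable_par n f : computable n f -> computable n (fun e => par (f e)).
Proof.
  intros Hf. apply (computable_rec n (fun _ => 0) (fun e => 1 - nth 1 e 0) f);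
    [apply computable_zero| |exact Hf].
  apply computable_sub; [apply computable_const|apply computable_proj].
Qed.

Definition bsum (m : nat) (F : nat -> nat) : nat :=
  nat_rect (fun _ => nat) 0 (fun k r => r + F k) m.

Lemma bsum_S m F : bsum (S m) F = bsum m F + F m.
Proof. reflexivity. Qed.

Lemma bsum_first m F : bsum (S m) F = F 0 + bsum m (fun k => F (S k)).
Proof.
  induction m as [|m IH]; [cbn; lia|].
  rewrite bsum_S, IH, bsum_S. lia.
Qed.

Lemma bsum_ext m F G : (forall k, k < m -> F k = G k) -> bsum m F = bsum m G.
Proof.
  induction m as [|m IH]; intros H; [reflexivity|].
  rewrite !bsum_S, IH, H; auto.
Qed.

Lemma bsum_eq0 m F : bsum m F = 0 <-> forall k, k < m -> F k = 0.
Proof.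
  induction m as [|m IH].
  - split; [intros; lia|reflexivity].
  - rewrite bsum_S. split.
    + intros H k Hk. destruct (Nat.eq_dec k m) as [->|]; [lia|].
      apply IH; lia.
    + intros H. rewrite (proj2 IH), (H m); auto.
Qed.

Lemma bsum_single m F a :
  a < m -> (forall k, k < m -> k <> a -> F k = 0) -> bsum m F = F a.
Proof.
  induction m as [|m IH]; intros Ha H; [lia|].
  rewrite bsum_S. destruct (Nat.eq_dec a m) as [->|Hne].
  - rewrite (proj2 (bsum_eq0 m F)); [reflexivity|]. intros; apply H; lia.
  - rewrite IH, (H m); auto; lia.
Qed.

Lemma computable_bsum n h F :
  computable n h -> computable (S n) (fun e => F (nth 0 e 0) (tl e)) ->
  computable n (fun e => bsum (h e) (fun k => F k e)).
Proof.
  intros Hh HF.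
  apply (computable_rec n (fun _ => 0)
    (fun e => nth 1 e 0 + F (nth 0 e 0) (tl (tl e))) h);
    [apply computable_zero| |exact Hh].
  apply computable_add; [apply computable_proj|].
  (* The summand must not see the accumulator in position 1; the index list [0 :: seq 2 n] skips
     it. *)
  eapply computable_ext;
    [|apply (computable_subst (S (S n)) (fun e => F (nth 0 e 0) (tl e)) (0 :: seq 2 n));
      simpl; rewrite length_seq; exact HF].
  intros [|x [|y e]] He; try discriminate. injection He as <-.
  pose proof (map_nth_seq e [x; y]) as E. simpl in E |- *. rewrite E. reflexivity.
Qed.

Lemma computable_call1 n f g :
  computable 1 (fun e => f (nth 0 e 0)) -> computable n g ->
  computable n (fun e => f (g e)).
Proof.
  intros Hf Hg. apply (computable_comp n (fun e => f (nth 0 e 0)) [g]);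
    repeat constructor; assumption.
Qed.

Lemma computable_call2 n f g h :
  computable 2 (fun e => f (nth 0 e 0) (nth 1 e 0)) ->
  computable n g -> computable n h -> computable n (fun e => f (g e) (h e)).
Proof.
  intros Hf Hg Hh.
  apply (computable_comp n (fun e => f (nth 0 e 0) (nth 1 e 0)) [g; h]);
    repeat constructor; assumption.
Qed.

Lemma computable_call3 n f g h k :
  computable 3 (fun e => f (nth 0 e 0) (nth 1 e 0) (nth 2 e 0)) ->
  computable n g -> computable n h -> computable n k ->
  computable n (fun e => f (g e) (h e) (k e)).
Proof.
  intros Hf Hg Hh Hk.
  apply (computable_comp n
    (fun e => f (nth 0 e 0) (nth 1 e 0) (nth 2 e 0)) [g; h; k]);
    repeat constructor; assumption.
Qed.

Lemma computable_nth_tl n i f :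
  computable n (fun e => nth (S i) (f e) 0) -> computable n (fun e => nth i (tl (f e)) 0).
Proof.
  apply computable_ext. intros e _. destruct (f e); [destruct i|]; reflexivity.
Qed.

Ltac computability :=
  repeat lazymatch goal with
  | |- computable _ (fun e => nth _ e 0) => apply computable_proj
  | |- computable _ (fun e => nth _ (tl _) 0) => apply computable_nth_tl
  | |- computable _ (fun e => S _) => apply computable_succ
  | |- computable _ (fun e => pred _) => apply computable_pred
  | |- computable _ (fun e => _ + _) => apply computable_add
  | |- computable _ (fun e => _ * _) => apply computable_mul
  | |- computable _ (fun e => _ - _) => apply computable_sub
  | |- computable _ (fun e => eqn _ _) => apply computable_eqn
  | |- computable _ (fun e => par _) => apply computable_par
  | |- computable _ (fun e => bsum _ _) => apply computable_bsum
  | |- computable _ (fun e => ?a) => apply computable_const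
  end.

(** Bounded search for the pair coded by [z], whose components are at most [z]. Injectivity of the
    pairing leaves at most one nonzero term, and doubling the equation avoids the division in
    [cantor_pair]. *)
Definition fst_code (z : nat) : nat :=
  bsum (S z) (fun a => bsum (S z) (fun b =>
    a * eqn ((a + b) * (a + b + 1) + 2 * b) (2 * z))).
Definition snd_code (z : nat) : nat :=
  bsum (S z) (fun a => bsum (S z) (fun b =>
    b * eqn ((a + b) * (a + b + 1) + 2 * b) (2 * z))).

Lemma computable_fst_code n f :
  computable n f -> computable n (fun e => fst_code (f e)).
Proof.
  apply computable_call1. unfold fst_code. computability.
Qed.

Lemma computable_snd_code n f :
  computable n f -> computable n (fun e => snd_code (f e)).
Proof.
  apply computable_call1. unfold snd_code. computability.
Qed.

Lemma double_cantor_pair a b :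
  2 * cantor_pair a b = (a + b) * (a + b + 1) + 2 * b.
Proof.
  unfold cantor_pair.
  assert (E : ((a + b) * (a + b + 1)) mod 2 = 0).
  { induction (a + b) as [|s IH]; [reflexivity|].
    replace (S s * (S s + 1)) with (s * (s + 1) + (s + 1) * 2) by lia.
    rewrite Nat.Div0.mod_add. exact IH. }
  pose proof (Nat.div_mod_eq ((a + b) * (a + b + 1)) 2). lia.
Qed.

(** The pairs of sum s take values between s(s+1)/2 and s(s+1)/2 + s. These intervals are disjoint
    for different s, so the value determines the sum and then [b]. *)
Lemma cantor_pair_inj a b c d :
  cantor_pair a b = cantor_pair c d -> a = c /\ b = d.
Proof.
  intros H. pose proof (double_cantor_pair a b) as H1.
  pose proof (double_cantor_pair c d) as H2.
  assert (a + b = c + d) by (destruct (Nat.lt_total (a + b) (c + d)) as [L|[L|L]]; nia).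
  replace (c + d) with (a + b) in H2 by assumption. lia.
Qed.

Lemma cantor_pair_ge a b : a <= cantor_pair a b /\ b <= cantor_pair a b.
Proof.
  pose proof (double_cantor_pair a b). nia.
Qed.

Lemma eqn_cantor_pair a b c d :
  eqn ((c + d) * (c + d + 1) + 2 * d) (2 * cantor_pair a b)
  = eqn a c * eqn b d.
Proof.
  rewrite <- double_cantor_pair. unfold eqn.
  destruct (Nat.eqb_spec (2 * cantor_pair c d) (2 * cantor_pair a b)) as [E|E].
  - destruct (cantor_pair_inj c d a b) as [-> ->]; [lia|].
    rewrite !Nat.eqb_refl. reflexivity.
  - destruct (Nat.eqb_spec a c) as [->|]; [|reflexivity].
    destruct (Nat.eqb_spec b d) as [->|]; [|reflexivity]. congruence.
Qed.

Lemma eqn_refl a : eqn a a = 1.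
Proof. unfold eqn. rewrite Nat.eqb_refl. reflexivity. Qed.

Lemma eqn_neq a b : a <> b -> eqn a b = 0.
Proof. unfold eqn. destruct (Nat.eqb_spec a b); congruence. Qed.

Lemma fst_code_pair a b : fst_code (cantor_pair a b) = a.
Proof.
  unfold fst_code. pose proof (cantor_pair_ge a b).
  rewrite (bsum_single _ _ a); [|lia|].
  - rewrite (bsum_single _ _ b); [|lia|].
    + rewrite eqn_cantor_pair, !eqn_refl. lia.
    + intros k _ Hk. rewrite eqn_cantor_pair, (eqn_neq b k) by congruence. lia.
  - intros c _ Hc. apply bsum_eq0. intros d _.
    rewrite eqn_cantor_pair, (eqn_neq a c) by congruence. lia.
Qed.

Lemma snd_code_pair a b : snd_code (cantor_pair a b) = b.
Proof.
  unfold snd_code. pose proof (cantor_pair_ge a b).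
  rewrite (bsum_single _ _ a); [|lia|].
  - rewrite (bsum_single _ _ b); [|lia|].
    + rewrite eqn_cantor_pair, !eqn_refl. lia.
    + intros k _ Hk. rewrite eqn_cantor_pair, (eqn_neq b k) by congruence. lia.
  - intros c _ Hc. apply bsum_eq0. intros d _.
    rewrite eqn_cantor_pair, (eqn_neq a c) by congruence. lia.
Qed.

(** The finitely many values are settled classically and built into the code as constants. Members
    get the value 0, so that [chi] can serve as a factor in [defect]. *)
Lemma computable_finite_set (X : nat -> Prop) M :
  (forall p, M <= p -> ~ X p) ->
  exists chi : nat -> nat,
    computable 1 (fun e => chi (nth 0 e 0)) /\
    forall p, (X p -> chi p = 0) /\ (~ X p -> chi p = 1).
Proof.
  revert X. induction M as [|M IH]; intros X HX.
  - exists (fun _ => 1). split; [apply computable_const|].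
    intros p. split; [|reflexivity]. intros Hp. destruct (HX p); [lia|exact Hp].
  - destruct (IH (fun p => X p /\ p <> M)) as [chi [Hc H]].
    { intros p Hp [H1 H2]. apply (HX p); [lia|exact H1]. }
    assert (exists b, (X M -> b = 0) /\ (~ X M -> b = 1)) as [b Hb].
    { destruct (classic (X M)); [exists 0|exists 1]; tauto. }
    exists (fun p => eqn p M * b + (1 - eqn p M) * chi p). split.
    + computability; exact Hc.
    + intros p. specialize (H p). destruct (Nat.eq_dec p M) as [->|Hne].
      * rewrite eqn_refl. replace (1 * b + (1 - 1) * chi M) with b by lia. exact Hb.
      * rewrite (eqn_neq p M Hne).
        replace (0 * b + (1 - 0) * chi p) with (chi p) by lia. tauto.
Qed.

(** * Reduced words *)

(** Reducedness in terms of adjacent letters; unlike the recursion in [reduce], this form behaves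
    well under the reversal in [finv]. *)
Definition alternating (w : word) : Prop :=
  forall l x y r, w = l ++ x :: y :: r -> cancels x y = false.

Lemma cancels_spec x y : cancels x y = true <-> y = (fst x, negb (snd x)).
Proof.
  destruct x as [i b], y as [j c]. unfold cancels. simpl.
  destruct (Nat.eqb_spec i j) as [->|Hne]; destruct b, c; simpl;
    split; congruence.
Qed.

Lemma alternating_cons x w :
  alternating w -> (forall y r, w = y :: r -> cancels x y = false) ->
  alternating (x :: w).
Proof.
  intros Hw Hx l a b r E. destruct l as [|z l]; injection E as -> E.
  - exact (Hx b r E).
  - exact (Hw l a b r E).
Qed.

Lemma alternating_tl x w : alternating (x :: w) -> alternating w.
Proof.
  intros H l a b r ->. exact (H (x :: l) a b r eq_refl).
Qed.

Lemma alternating_reduce w : alternating (reduce w).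
Proof.
  induction w as [|x w IH]; simpl.
  - intros [|? [|]] ? ? ? E; discriminate.
  - destruct (reduce w) as [|y r].
    + apply alternating_cons; [exact IH|discriminate].
    + destruct (cancels x y) eqn:E; [exact (alternating_tl _ _ IH)|].
      apply alternating_cons; [exact IH|]. intros ? ? [= <- <-]. exact E.
Qed.

Lemma reduce_alternating w : alternating w -> reduce w = w.
Proof.
  induction w as [|x w IH]; intros H; simpl; [reflexivity|].
  rewrite IH by exact (alternating_tl _ _ H).
  destruct w as [|y r]; [reflexivity|].
  rewrite (H [] x y r eq_refl). reflexivity.
Qed.

Lemma reduce_idempotent w : reduce (reduce w) = reduce w.
Proof. apply reduce_alternating, alternating_reduce. Qed.

Lemma Forall_reduce (P : letter -> Prop) w : Forall P w -> Forall P (reduce w).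
Proof.
  induction 1 as [|x w Hx _ IH]; simpl; [constructor|].
  destruct (reduce w) as [|y r]; [repeat constructor; exact Hx|].
  destruct (cancels x y); [inversion IH; assumption|constructor; assumption].
Qed.

Lemma in_Fn_reduce n w : Forall (fun x => fst x < n) w -> in_Fn n (reduce w).
Proof.
  intros H. split; [apply reduce_idempotent|apply Forall_reduce, H].
Qed.

Lemma in_Fn_fmul n u v : in_Fn n u -> in_Fn n v -> in_Fn n (fmul u v).
Proof.
  intros [_ Hu] [_ Hv]. apply in_Fn_reduce, Forall_app. split; assumption.
Qed.

Lemma cancels_inverse x y :
  cancels (fst x, negb (snd x)) (fst y, negb (snd y)) = cancels y x.
Proof.
  destruct x as [i b], y as [j c]. unfold cancels. simpl.
  rewrite Nat.eqb_sym. destruct b, c; reflexivity.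
Qed.

Lemma finv_app u v : finv (u ++ v) = finv v ++ finv u.
Proof. unfold finv. rewrite map_app. apply rev_app_distr. Qed.

Lemma finv_involutive w : finv (finv w) = w.
Proof.
  induction w as [|[i b] w IH]; [reflexivity|].
  change (finv (finv w ++ [(i, negb b)]) = (i, b) :: w).
  rewrite finv_app, IH. simpl. rewrite negb_involutive. reflexivity.
Qed.

Lemma in_Fn_finv n w : in_Fn n w -> in_Fn n (finv w).
Proof.
  intros [Hr Hw]. split.
  - apply reduce_alternating. intros l x y r E.
    pose proof (alternating_reduce w) as Ha. rewrite Hr in Ha.
    apply (f_equal finv) in E.
    rewrite finv_involutive, finv_app in E. unfold finv in E at 1. simpl in E.
    rewrite <- !app_assoc in E. apply Ha in E. rewrite cancels_inverse in E. exact E.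
  - apply Forall_rev, Forall_map. exact Hw.
Qed.

(** * A central extension of the lamplighter group *)

Local Open Scope Z_scope.

(** Letter 0 acts as the translation of Z by 1, letter 1 as the lamp at 0, and all further letters
    as the identity. The sign of letter 1 is irrelevant since lamps are involutions. *)
Definition tau (x : letter) : Z :=
  if Nat.eqb (fst x) 0 then (if snd x then 1 else -1) else 0.

Definition height (w : word) : Z := fold_right (fun x h => tau x + h) 0 w.

(** Pushing all translations to the right turns [w] into a product of lamps at these positions, in
    this order, followed by the translation by [height w]. *)
Fixpoint lamps (w : word) : list Z :=
  match w with
  | [] => []
  | x :: w' => (if Nat.eqb (fst x) 1 then [0] else []) ++ map (Z.add (tau x)) (lamps w')
  end.

Definition odd_count (L : list Z) (i : Z) : bool :=
  fold_right (fun j b => xorb (i =? j) b) false L.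

(** For p > 0 this is the exponent of z_p that appears when the product of lamps is sorted into
    increasing order: each lamp at i that precedes a lamp at i - p contributes one commutator. *)
Fixpoint odd_pairs (L : list Z) (p : Z) : bool :=
  match L with
  | [] => false
  | i :: L' => xorb (odd_count L' (i - p)) (odd_pairs L' p)
  end.

(** The cocycle of the central extension; it is bilinear in the parities of the two lists. *)
Definition odd_cross (L L' : list Z) (p : Z) : bool :=
  fold_right (fun i b => xorb (odd_count L' (i - p)) b) false L.

Lemma odd_count_app L L' i :
  odd_count (L ++ L') i = xorb (odd_count L i) (odd_count L' i).
Proof.
  induction L as [|j L IH]; simpl; [destruct (odd_count L' i); reflexivity|].
  rewrite IH, xorb_assoc. reflexivity.
Qed.

Lemma odd_count_shift t L i : odd_count (map (Z.add t) L) i = odd_count L (i - t).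
Proof.
  induction L as [|j L IH]; simpl; [reflexivity|]. rewrite IH. f_equal.
  destruct (Z.eqb_spec i (t + j)), (Z.eqb_spec (i - t) j); lia.
Qed.

Lemma odd_pairs_shift t L p : odd_pairs (map (Z.add t) L) p = odd_pairs L p.
Proof.
  induction L as [|i L IH]; simpl; [reflexivity|].
  rewrite IH, odd_count_shift. do 2 f_equal. lia.
Qed.

Lemma odd_pairs_app L L' p :
  odd_pairs (L ++ L') p
  = xorb (odd_cross L L' p) (xorb (odd_pairs L p) (odd_pairs L' p)).
Proof.
  induction L as [|i L IH]; simpl; [destruct (odd_pairs L' p); reflexivity|].
  rewrite IH, odd_count_app.
  destruct (odd_count L (i - p)), (odd_count L' (i - p)), (odd_cross L L' p),
    (odd_pairs L p), (odd_pairs L' p); reflexivity.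
Qed.

Lemma odd_cross_even_r L L' p :
  (forall i, odd_count L' i = false) -> odd_cross L L' p = false.
Proof.
  intros H. induction L as [|i L IH]; simpl; [reflexivity|].
  rewrite IH, H. reflexivity.
Qed.

Lemma odd_cross_nil_r L p : odd_cross L [] p = false.
Proof. apply odd_cross_even_r. reflexivity. Qed.

(** Expansion in the second list, from which the cocycle is seen to vanish when the first list is
    even. *)
Lemma odd_cross_cons_r L j L' p :
  odd_cross L (j :: L') p = xorb (odd_count L (j + p)) (odd_cross L L' p).
Proof.
  induction L as [|i L IH]; simpl; [reflexivity|]. rewrite IH.
  replace (j + p =? i) with (i - p =? j)
    by (destruct (Z.eqb_spec (i - p) j), (Z.eqb_spec (j + p) i); lia).
  destruct (i - p =? j), (odd_count L' (i - p)), (odd_count L (j + p)),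
    (odd_cross L L' p); reflexivity.
Qed.

Lemma odd_cross_even_l L L' p :
  (forall i, odd_count L i = false) -> odd_cross L L' p = false.
Proof.
  intros H. induction L' as [|j L' IH]; [apply odd_cross_nil_r|].
  rewrite odd_cross_cons_r, IH, H. reflexivity.
Qed.

Lemma height_cons x w : height (x :: w) = tau x + height w.
Proof. reflexivity. Qed.

Lemma lamps_cons x w :
  lamps (x :: w)
  = (if (fst x =? 1)%nat then [0] else []) ++ map (Z.add (tau x)) (lamps w).
Proof. reflexivity. Qed.

Lemma height_app u v : height (u ++ v) = height u + height v.
Proof. induction u as [|x u IH]; simpl; lia. Qed.

Lemma lamps_app u v : lamps (u ++ v) = lamps u ++ map (Z.add (height u)) (lamps v).
Proof.
  induction u as [|x u IH]; simpl.
  - symmetry. rewrite <- map_id. apply map_ext. intros; lia.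
  - rewrite IH, map_app, map_map, <- app_assoc. do 2 f_equal.
    apply map_ext. intros; lia.
Qed.

Definition lamps_count (w : word) (i : Z) : bool := odd_count (lamps w) i.
Definition lamps_pairs (w : word) (p : Z) : bool := odd_pairs (lamps w) p.

Lemma lamps_count_app u v i :
  lamps_count (u ++ v) i = xorb (lamps_count u i) (lamps_count v (i - height u)).
Proof.
  unfold lamps_count. rewrite lamps_app, odd_count_app, odd_count_shift. reflexivity.
Qed.

Lemma lamps_pairs_app_even_l u v p :
  (forall i, lamps_count u i = false) ->
  lamps_pairs (u ++ v) p = xorb (lamps_pairs u p) (lamps_pairs v p).
Proof.
  intros H. unfold lamps_pairs.
  rewrite lamps_app, odd_pairs_app, odd_pairs_shift, odd_cross_even_l by exact H.
  apply xorb_false_l.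
Qed.

Lemma odd_cross_ext L L1 L2 p :
  (forall i, odd_count L1 i = odd_count L2 i) -> odd_cross L L1 p = odd_cross L L2 p.
Proof.
  intros H. induction L as [|i L IH]; simpl; [reflexivity|]. rewrite IH, H. reflexivity.
Qed.

(** Left multiplication by [u] adds to the z_p coordinate a term that sees the right factor only
    through its lamp parities. This handles conjugates. *)
Lemma lamps_pairs_app_ext u v w p :
  (forall i, lamps_count v i = lamps_count w i) ->
  xorb (lamps_pairs (u ++ v) p) (lamps_pairs v p)
  = xorb (lamps_pairs (u ++ w) p) (lamps_pairs w p).
Proof.
  intros H. unfold lamps_pairs. rewrite !lamps_app, !odd_pairs_app, !odd_pairs_shift.
  rewrite (odd_cross_ext _ _ (map (Z.add (height u)) (lamps w))).
  - rewrite !xorb_assoc, !xorb_nilpotent. reflexivity.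
  - intros i. rewrite !odd_count_shift. apply H.
Qed.

Lemma lamps_count_cons x w i :
  lamps_count (x :: w) i
  = xorb ((fst x =? 1)%nat && (i =? 0)) (lamps_count w (i - tau x)).
Proof.
  unfold lamps_count. simpl. rewrite odd_count_app, odd_count_shift.
  destruct (fst x =? 1)%nat; [|reflexivity]. simpl. rewrite xorb_false_r. reflexivity.
Qed.

Lemma lamps_pairs_cons x w p :
  lamps_pairs (x :: w) p
  = xorb ((fst x =? 1)%nat && lamps_count w (- p)) (lamps_pairs w p).
Proof.
  unfold lamps_pairs, lamps_count. simpl. rewrite odd_pairs_app, odd_pairs_shift.
  destruct (Nat.eqb_spec (fst x) 1) as [E|]; simpl; [|apply xorb_false_l].
  unfold tau. rewrite E. simpl. rewrite odd_count_shift, xorb_false_r, Z.sub_0_r.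
  reflexivity.
Qed.

(* Equality in the group, which is Z acting by translation on the extension of
   the space of finite subsets of Z by central involutions z_p, p > 0. *)
Definition same_element (u v : word) : Prop :=
  height u = height v /\ (forall i, lamps_count u i = lamps_count v i) /\
  (forall p, 0 < p -> lamps_pairs u p = lamps_pairs v p).

Lemma same_element_cons x u v : same_element u v -> same_element (x :: u) (x :: v).
Proof.
  intros (H1 & H2 & H3). repeat split.
  - simpl. rewrite H1. reflexivity.
  - intros i. rewrite !lamps_count_cons, H2. reflexivity.
  - intros p Hp. rewrite !lamps_pairs_cons, H2, H3 by exact Hp. reflexivity.
Qed.

Lemma same_element_app r u v : same_element u v -> same_element (r ++ u) (r ++ v).
Proof.
  intros H. induction r as [|x r IH]; [exact H|]. apply same_element_cons, IH.
Qed.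

Lemma same_element_trans u v w :
  same_element u v -> same_element v w -> same_element u w.
Proof.
  intros (H1 & H2 & H3) (H4 & H5 & H6). repeat split.
  - congruence.
  - intros i. rewrite H2. apply H5.
  - intros p Hp. rewrite H3 by exact Hp. apply H6, Hp.
Qed.

Lemma same_element_sym u v : same_element u v -> same_element v u.
Proof.
  intros (H1 & H2 & H3). repeat split; intros; symmetry; auto.
Qed.

Lemma same_element_refl u : same_element u u.
Proof. repeat split. Qed.

Lemma same_element_cancel x y w : cancels x y = true -> same_element (x :: y :: w) w.
Proof.
  rewrite cancels_spec. intros ->. destruct x as [i b].
  assert (E : tau (i, negb b) = - tau (i, b))
    by (unfold tau; destruct i, b; reflexivity).
  repeat split; cbn [fst snd].
  - simpl height. rewrite E. lia.
  - intros j. rewrite !lamps_count_cons, E, <- xorb_assoc. cbn [fst].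
    replace (j - tau (i, b) - - tau (i, b)) with j by lia.
    destruct (Nat.eqb_spec i 1) as [->|].
    + unfold tau. simpl. rewrite Z.sub_0_r, xorb_nilpotent. apply xorb_false_l.
    + apply xorb_false_l.
  - intros p Hp. rewrite !lamps_pairs_cons, lamps_count_cons, E. cbn [fst].
    destruct (Nat.eqb_spec i 1) as [->|]; simpl; [|destruct (lamps_pairs w p); reflexivity].
    (* The two cancelling lamps sit at the same position, hence are not at distance p > 0 and create
       no z_p. *)
    replace (- p =? 0) with false by (symmetry; apply Z.eqb_neq; lia).
    unfold tau. simpl. rewrite Z.sub_0_r.
    destruct (lamps_count w (- p)), (lamps_pairs w p); reflexivity.
Qed.

Lemma same_element_reduce_app w v : same_element (reduce w ++ v) (w ++ v).
Proof.
  induction w as [|x w IH]; simpl; [apply same_element_refl|].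
  apply (same_element_cons x) in IH.
  destruct (reduce w) as [|y r]; [exact IH|].
  destruct (cancels x y) eqn:E; [|exact IH].
  apply same_element_trans with (x :: y :: r ++ v); [|exact IH].
  apply same_element_sym, same_element_cancel, E.
Qed.

Lemma same_element_reduce w : same_element (reduce w) w.
Proof.
  pose proof (same_element_reduce_app w []) as H. rewrite !app_nil_r in H. exact H.
Qed.

Lemma same_element_finv_r u : same_element (u ++ finv u) [].
Proof.
  induction u as [|x u IH] using rev_ind; [apply same_element_refl|].
  unfold finv. rewrite map_app, rev_app_distr. simpl.
  rewrite <- app_assoc. simpl.
  apply same_element_trans with (u ++ finv u); [|exact IH].
  apply same_element_app, same_element_cancel, cancels_spec. reflexivity.
Qed.

(** These are the reduced words that represent a product of some z_p with p in [S]. *)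
Definition lamp_subgroup (n : nat) (S : nat -> Prop) (w : word) : Prop :=
  in_Fn n w /\ height w = 0 /\ (forall i, lamps_count w i = false) /\
  (forall p : nat, (0 < p)%nat -> ~ S p -> lamps_pairs w (Z.of_nat p) = false).

Lemma lamp_subgroup_same n S u v :
  in_Fn n u -> same_element u v ->
  height v = 0 -> (forall i, lamps_count v i = false) ->
  (forall p : nat, (0 < p)%nat -> ~ S p -> lamps_pairs v (Z.of_nat p) = false) ->
  lamp_subgroup n S u.
Proof.
  intros H0 (H1 & H2 & H3) H4 H5 H6. repeat split; try apply H0.
  - congruence.
  - intros i. rewrite H2. apply H5.
  - intros p Hp Sp. rewrite H3 by lia. apply H6; assumption.
Qed.

Lemma lamp_subgroup_normal n S : is_normal_subgroup n (lamp_subgroup n S).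
Proof.
  split; [|split; [|split; [|split]]].
  - intros w Hw. apply Hw.
  - repeat split; constructor.
  - intros u v (Fu & Tu & Cu & Pu) (Fv & Tv & Cv & Pv).
    apply lamp_subgroup_same with (u ++ v);
      [apply in_Fn_fmul; assumption|apply same_element_reduce|..].
    + rewrite height_app. lia.
    + intros i. rewrite lamps_count_app, Cu, Cv. reflexivity.
    + intros p Hp Sp. rewrite lamps_pairs_app_even_l, Pu, Pv by assumption. reflexivity.
  - intros u (Fu & Tu & Cu & Pu).
    destruct (same_element_finv_r u) as (H1 & H2 & H3).
    rewrite height_app in H1. cbn in H1.
    apply lamp_subgroup_same with (finv u);
      [apply in_Fn_finv, Fu|apply same_element_refl|lia|..].
    + intros i. specialize (H2 i).
      rewrite lamps_count_app, Cu, Tu, Z.sub_0_r, xorb_false_l in H2. exact H2.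
    + intros p Hp Sp. specialize (H3 (Z.of_nat p) ltac:(lia)).
      rewrite lamps_pairs_app_even_l, Pu, xorb_false_l in H3 by assumption. exact H3.
  - intros g u Fg (Fu & Tu & Cu & Pu).
    destruct (same_element_finv_r g) as (H1 & H2 & H3).
    rewrite height_app in H1. cbn in H1.
    apply lamp_subgroup_same with (g ++ u ++ finv g).
    + apply in_Fn_fmul; [apply in_Fn_fmul|apply in_Fn_finv]; assumption.
    + apply same_element_trans with (fmul g u ++ finv g); [apply same_element_reduce|].
      rewrite app_assoc. apply same_element_reduce_app.
    + rewrite !height_app. lia.
    + intros i. transitivity (lamps_count (g ++ finv g) i); [|exact (H2 i)].
      rewrite !lamps_count_app, Cu, Tu, Z.sub_0_r, xorb_false_l. reflexivity.
    + intros p Hp Sp. specialize (H3 (Z.of_nat p) ltac:(lia)).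
      (* As [u] has trivial translation and lamps, [u ++ finv g] and [finv g] have the same lamp
         parities, so prefixing [g] changes their z_p coordinates alike; and [g ++ finv g] is
         trivial. *)
      assert (E : forall i, lamps_count (u ++ finv g) i = lamps_count (finv g) i).
      { intros i. rewrite lamps_count_app, Cu, Tu, Z.sub_0_r. apply xorb_false_l. }
      apply (lamps_pairs_app_ext g _ _ (Z.of_nat p)) in E.
      rewrite H3, (lamps_pairs_app_even_l u), Pu in E by assumption.
      apply (f_equal (fun b => xorb b (lamps_pairs (finv g) (Z.of_nat p)))) in E.
      rewrite xorb_false_l, !xorb_assoc, xorb_nilpotent, xorb_false_r in E. exact E.
Qed.

(** * Central witnesses *)

Definition translate (b : bool) (p : nat) : word := repeat (0%nat, b) p.

Lemma height_translate b p : height (translate b p) = (if b then 1 else -1) * Z.of_nat p.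
Proof.
  induction p as [|p IH]; [destruct b; reflexivity|].
  change (height (translate b (S p))) with (tau (0%nat, b) + height (translate b p)).
  rewrite IH.
  destruct b; [change (tau _) with 1|change (tau _) with (-1)]; cbv iota; lia.
Qed.

Lemma lamps_translate b p : lamps (translate b p) = [].
Proof.
  induction p as [|p IH]; [reflexivity|].
  change (map (Z.add (tau (0%nat, b))) (lamps (translate b p)) = []).
  rewrite IH. reflexivity.
Qed.

Definition half_witness (p : nat) : word :=
  (1%nat, true) :: translate true p ++ (1%nat, true) :: translate false p.

(* The commutator of the lamps at 0 and p; since lamps are involutions, it is the square
   of their product. *)
Definition witness (p : nat) : word := reduce (half_witness p ++ half_witness p).

Lemma in_Fn_witness n p : (1 < n)%nat -> in_Fn n (witness p).
Proof.
  intros Hn. apply in_Fn_reduce.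
  assert (H : Forall (fun x : letter => (fst x < n)%nat) (half_witness p)).
  { assert (Ht : forall b, Forall (fun x : letter => (fst x < n)%nat) (translate b p)).
    { intros b. apply Forall_forall. intros x Hx. apply repeat_spec in Hx.
      subst x. simpl. lia. }
    constructor; [exact Hn|]. apply Forall_app. split; [apply Ht|].
    constructor; [exact Hn|apply Ht]. }
  apply Forall_app. split; exact H.
Qed.

Lemma height_half_witness p : height (half_witness p) = 0.
Proof.
  unfold half_witness.
  rewrite height_cons, height_app, height_cons, !height_translate.
  change (tau (1%nat, true)) with 0. cbv iota. lia.
Qed.

Lemma lamps_half_witness p : lamps (half_witness p) = [0; Z.of_nat p].
Proof.
  unfold half_witness.
  rewrite lamps_cons, lamps_app, lamps_cons, !lamps_translate, height_translate.
  change (tau (1%nat, true)) with 0. cbn -[Z.mul Z.add]. repeat f_equal. lia.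
Qed.

(** The lamps of the unreduced witness are at 0, p, 0, p. Each position occurs twice, and the only
    inversion is the first p before the second 0, so the witness represents z_p. *)
Lemma lamp_subgroup_witness n S p :
  (1 < n)%nat -> (0 < p)%nat -> (lamp_subgroup n S (witness p) <-> S p).
Proof.
  intros Hn Hp.
  assert (E : lamps (half_witness p ++ half_witness p)
    = [0; Z.of_nat p; 0; Z.of_nat p]).
  { rewrite lamps_app, lamps_half_witness, height_half_witness. reflexivity. }
  assert (Eq : forall q : nat, (0 < q)%nat ->
    lamps_pairs (half_witness p ++ half_witness p) (Z.of_nat q) = (p =? q)%nat).
  { intros q Hq. unfold lamps_pairs. rewrite E. simpl.
    repeat match goal with
    | |- context [Z.eqb ?a ?b] => destruct (Z.eqb_spec a b)
    end; destruct (Nat.eqb_spec p q); simpl; try reflexivity; lia. }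
  destruct (same_element_reduce (half_witness p ++ half_witness p)) as (H1 & H2 & H3).
  split.
  - intros (_ & _ & _ & H). apply NNPP. intros Sp. specialize (H p Hp Sp).
    unfold witness in H. rewrite H3, Eq, Nat.eqb_refl in H by lia. discriminate.
  - intros Sp. apply lamp_subgroup_same with (half_witness p ++ half_witness p).
    + apply in_Fn_witness, Hn.
    + apply same_element_reduce.
    + rewrite height_app, height_half_witness. reflexivity.
    + intros i. unfold lamps_count. rewrite E. simpl.
      destruct (i =? 0), (i =? Z.of_nat p); reflexivity.
    + intros q Hq Sq. rewrite Eq by exact Hq.
      apply Nat.eqb_neq. intros ->. contradiction.
Qed.

Lemma lamps_count_far w i : Z.of_nat (length w) < Z.abs i -> lamps_count w i = false.
Proof.
  revert i. induction w as [|x w IH]; intros i Hi; [reflexivity|].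
  rewrite lamps_count_cons. simpl length in Hi.
  replace (i =? 0) with false by (symmetry; apply Z.eqb_neq; lia).
  rewrite andb_false_r, xorb_false_l. apply IH.
  unfold tau. destruct (fst x =? 0)%nat, (snd x); lia.
Qed.

(** A word shorter than p cannot reach two positions at distance p. Both the finite search in
    [defect] and the continuity of the reduction rest on this. *)
Lemma lamps_pairs_far w p : Z.of_nat (length w) < p -> lamps_pairs w p = false.
Proof.
  induction w as [|x w IH]; intros Hp; [reflexivity|].
  simpl length in Hp.
  rewrite lamps_pairs_cons, IH, lamps_count_far by lia.
  rewrite andb_false_r. reflexivity.
Qed.

Local Open Scope nat_scope.

(** * Deciding membership *)

Definition tail_code (x : nat) : nat := snd_code (pred x).
Definition drop_code (k x : nat) : nat := nat_rect (fun _ => nat) x (fun _ r => tail_code r) k.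

(* Letter codes: 0 and 1 are the translations by -1 and 1, 2 and 3 the lamp at 0; beyond
   the end of the word, [drop_code k x] is 0 and every test fails. *)
Definition letter_test (c k x : nat) : nat :=
  (1 - eqn (drop_code k x) 0) * eqn (fst_code (pred (drop_code k x))) c.

Definition letter_count (c k x : nat) : nat := bsum k (fun l => letter_test c l x).
Definition lamp_test (k x : nat) : nat := letter_test 2 k x + letter_test 3 k x.

(* Sums run over [k < x] since a word is no longer than its code. The position
   compared with the height before letter [k] is [i - j]. *)
Definition count_at (x i j : nat) : nat :=
  bsum x (fun k => lamp_test k x *
    eqn (letter_count 1 k x + j) (i + letter_count 0 k x)).
(** Positions are relative to the lamp at letter [k]; its partner in the rest of the word is at -p,
    passed to [count_at] as the difference of 0 and p. *)
Definition pair_count (x p : nat) : nat :=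
  bsum x (fun k => lamp_test k x * count_at (drop_code (S k) x) 0 p).

(** Three nonnegative terms measure translation, lamps and central part. Swapping the last arguments
    of [count_at] reaches the negative positions, and [chi], being 0 on the chosen set, switches off
    the coordinates that are killed in the quotient. *)
Definition defect (chi : nat -> nat) (x : nat) : nat :=
  1 - eqn (letter_count 1 x x) (letter_count 0 x x)
  + (bsum (S x) (fun i => par (count_at x i 0) + par (count_at x 0 i))
  + bsum x (fun p => chi (S p) * par (pair_count x (S p)))).

Lemma computable_drop_code n f g :
  computable n f -> computable n g -> computable n (fun e => drop_code (f e) (g e)).
Proof.
  intros Hf Hg.
  apply (computable_rec n g (fun e => tail_code (nth 1 e 0)) f); try assumption.
  apply computable_snd_code. computability.
Qed.

Lemma computable_letter_test n c f g :
  computable n f -> computable n g -> computable n (fun e => letter_test c (f e) (g e)).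
Proof.
  apply computable_call2. unfold letter_test. computability.
  - apply computable_drop_code; computability.
  - apply (computable_fst_code _ (fun e => pred (drop_code (nth 0 e 0) (nth 1 e 0)))).
    computability. apply computable_drop_code; computability.
Qed.

Lemma computable_letter_count n c f g :
  computable n f -> computable n g -> computable n (fun e => letter_count c (f e) (g e)).
Proof.
  apply computable_call2. unfold letter_count. computability.
  apply computable_letter_test; computability.
Qed.

Lemma computable_lamp_test n f g :
  computable n f -> computable n g -> computable n (fun e => lamp_test (f e) (g e)).
Proof.
  intros Hf Hg. apply computable_add; apply computable_letter_test; assumption.
Qed.

Lemma computable_count_at n f g h :
  computable n f -> computable n g -> computable n h ->
  computable n (fun e => count_at (f e) (g e) (h e)).
Proof.
  apply computable_call3. unfold count_at. computability.
  - apply computable_lamp_test; computability.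
  - apply computable_letter_count; computability.
  - apply computable_letter_count; computability.
Qed.

Lemma computable_pair_count n f g :
  computable n f -> computable n g -> computable n (fun e => pair_count (f e) (g e)).
Proof.
  apply computable_call2. unfold pair_count. computability.
  - apply computable_lamp_test; computability.
  - apply computable_count_at; computability.
    apply (computable_drop_code _ (fun e => S (nth 0 e 0))); computability.
Qed.

Lemma computable_defect chi :
  computable 1 (fun e => chi (nth 0 e 0)) ->
  computable 1 (fun e => defect chi (nth 0 e 0)).
Proof.
  intros Hchi. unfold defect. computability.
  - apply computable_letter_count; computability.
  - apply computable_letter_count; computability.
  - apply computable_count_at; computability.
  - apply computable_count_at; computability.
  - apply (computable_call1 _ _ (fun e => S (nth 0 e 0)) Hchi); computability.
  - apply (computable_pair_count _ _ (fun e => S (nth 0 e 0))); computability.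
Qed.

Lemma length_le_encode_word w : length w <= encode_word w.
Proof.
  induction w as [|a w IH]; simpl; [lia|].
  pose proof (cantor_pair_ge (encode_letter a) (encode_word w)). lia.
Qed.

Lemma tail_code_cons a w : tail_code (encode_word (a :: w)) = encode_word w.
Proof. apply snd_code_pair. Qed.

Lemma drop_code_S k x : drop_code (S k) x = drop_code k (tail_code x).
Proof.
  induction k as [|k IH]; [reflexivity|].
  change (tail_code (drop_code (S k) x) = tail_code (drop_code k (tail_code x))).
  rewrite IH. reflexivity.
Qed.

Lemma drop_code_nil k : drop_code k 0 = 0.
Proof.
  induction k as [|k IH]; [reflexivity|].
  change (tail_code (drop_code k 0) = 0). rewrite IH. reflexivity.
Qed.

Lemma drop_code_cons k a w :
  drop_code (S k) (encode_word (a :: w)) = drop_code k (encode_word w).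
Proof. rewrite drop_code_S, tail_code_cons. reflexivity. Qed.

Lemma letter_test_nil c k : letter_test c k (encode_word []) = 0.
Proof. unfold letter_test. simpl encode_word. rewrite drop_code_nil. reflexivity. Qed.

Lemma letter_test_first c a w :
  letter_test c 0 (encode_word (a :: w)) = eqn (encode_letter a) c.
Proof.
  unfold letter_test. change (drop_code 0 ?x) with x. cbn [encode_word pred].
  rewrite fst_code_pair. unfold eqn at 1. simpl. lia.
Qed.

Lemma letter_test_cons c k a w :
  letter_test c (S k) (encode_word (a :: w)) = letter_test c k (encode_word w).
Proof. unfold letter_test. rewrite drop_code_cons. reflexivity. Qed.

Lemma letter_count_cons c k a w :
  letter_count c (S k) (encode_word (a :: w))
  = eqn (encode_letter a) c + letter_count c k (encode_word w).
Proof.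
  unfold letter_count. rewrite bsum_first, letter_test_first. f_equal.
  apply bsum_ext. intros l _. apply letter_test_cons.
Qed.

Lemma lamp_test_cons k a w :
  lamp_test (S k) (encode_word (a :: w)) = lamp_test k (encode_word w).
Proof. unfold lamp_test. rewrite !letter_test_cons. reflexivity. Qed.

Lemma lamp_test_first a w :
  lamp_test 0 (encode_word (a :: w)) = Nat.b2n (fst a =? 1).
Proof.
  unfold lamp_test. rewrite !letter_test_first. unfold encode_letter, eqn.
  destruct a as [[|[|i]] []]; cbn [fst snd]; try reflexivity.
  - destruct (Nat.eqb_spec (2 * S (S i) + 1) 2), (Nat.eqb_spec (2 * S (S i) + 1) 3);
      simpl; lia.
  - destruct (Nat.eqb_spec (2 * S (S i) + 0) 2), (Nat.eqb_spec (2 * S (S i) + 0) 3);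
      simpl; lia.
Qed.

Lemma tau_eqn a :
  tau a = (Z.of_nat (eqn (encode_letter a) 1) - Z.of_nat (eqn (encode_letter a) 0))%Z.
Proof.
  unfold encode_letter, eqn, tau. destruct a as [[|i] []]; cbn [fst snd]; try reflexivity.
  - replace (2 * S i + 1 =? 1) with false by (symmetry; apply Nat.eqb_neq; lia).
    replace (2 * S i + 1 =? 0) with false by (symmetry; apply Nat.eqb_neq; lia).
    reflexivity.
  - replace (2 * S i + 0 =? 1) with false by (symmetry; apply Nat.eqb_neq; lia).
    replace (2 * S i + 0 =? 0) with false by (symmetry; apply Nat.eqb_neq; lia).
    reflexivity.
Qed.

Lemma height_letter_count w K : length w <= K ->
  height w = (Z.of_nat (letter_count 1 K (encode_word w))
    - Z.of_nat (letter_count 0 K (encode_word w)))%Z.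
Proof.
  revert K. induction w as [|a w IH]; intros K HK.
  - unfold letter_count.
    rewrite !(proj2 (bsum_eq0 _ _)) by (intros; apply letter_test_nil). reflexivity.
  - destruct K as [|K]; simpl in HK; [lia|].
    change (height (a :: w)) with (tau a + height w)%Z.
    rewrite !letter_count_cons, tau_eqn, (IH K) by lia. lia.
Qed.

Lemma odd_b2n b : Nat.odd (Nat.b2n b) = b.
Proof. destruct b; reflexivity. Qed.

(** The bound [K] is separated from the code so that induction can pass to the tail of the word,
    whose code is a different number. *)
Lemma odd_count_at_bound w K i j : length w <= K ->
  Nat.odd (bsum K (fun k => lamp_test k (encode_word w) *
    eqn (letter_count 1 k (encode_word w) + j) (i + letter_count 0 k (encode_word w))))
  = lamps_count w (Z.of_nat i - Z.of_nat j).
Proof.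
  revert K i j. induction w as [|a w IH]; intros K i j HK.
  - rewrite (proj2 (bsum_eq0 _ _)); [reflexivity|].
    intros k _. unfold lamp_test. rewrite !letter_test_nil. reflexivity.
  - destruct K as [|K]; simpl in HK; [lia|].
    rewrite bsum_first, Nat.odd_add, lamp_test_first, Nat.odd_mul, odd_b2n.
    rewrite lamps_count_cons. f_equal.
    + f_equal. unfold letter_count, eqn. simpl bsum.
      destruct (Nat.eqb_spec (0 + j) (i + 0)), (Z.eqb_spec (Z.of_nat i - Z.of_nat j) 0);
        simpl; try reflexivity; lia.
    (* The first letter shifts all later heights; its contribution is absorbed into [j] or [i],
       according to its sign, so that no subtraction occurs. *)
    + rewrite (bsum_ext _ _ (fun k => lamp_test k (encode_word w) *
        eqn (letter_count 1 k (encode_word w) + (eqn (encode_letter a) 1 + j))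
          ((i + eqn (encode_letter a) 0) + letter_count 0 k (encode_word w)))).
      * rewrite IH by lia. f_equal. rewrite tau_eqn. lia.
      * intros k _. rewrite lamp_test_cons, !letter_count_cons. do 2 f_equal; lia.
Qed.

Lemma odd_count_at w i j :
  Nat.odd (count_at (encode_word w) i j) = lamps_count w (Z.of_nat i - Z.of_nat j).
Proof. apply odd_count_at_bound, length_le_encode_word. Qed.

Lemma odd_pair_count w p :
  Nat.odd (pair_count (encode_word w) p) = lamps_pairs w (Z.of_nat p).
Proof.
  enough (H : forall K, length w <= K ->
    Nat.odd (bsum K (fun k => lamp_test k (encode_word w) *
      count_at (drop_code (S k) (encode_word w)) 0 p)) = lamps_pairs w (Z.of_nat p))
    by apply H, length_le_encode_word.
  induction w as [|a w IH]; intros K HK.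
  - rewrite (proj2 (bsum_eq0 _ _)); [reflexivity|].
    intros k _. unfold lamp_test. rewrite !letter_test_nil. reflexivity.
  - destruct K as [|K]; simpl in HK; [lia|].
    rewrite bsum_first, Nat.odd_add, lamp_test_first, Nat.odd_mul, odd_b2n.
    rewrite lamps_pairs_cons, drop_code_cons. f_equal.
    + f_equal. change (drop_code 0 ?x) with x. apply odd_count_at.
    + rewrite <- (IH K) by lia. f_equal. apply bsum_ext. intros k _.
      rewrite lamp_test_cons, drop_code_cons. reflexivity.
Qed.

Lemma par_eq0 z : par z = 0 <-> Nat.odd z = false.
Proof. rewrite par_odd. destruct (Nat.odd z); split; easy. Qed.

Lemma defect_eq0 n S chi w :
  (forall p, (S p -> chi p = 0) /\ (~ S p -> chi p = 1)) -> in_Fn n w ->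
  (defect chi (encode_word w) = 0 <-> lamp_subgroup n S w).
Proof.
  intros Hchi Hw. set (x := encode_word w).
  pose proof (length_le_encode_word w) as Hlen. fold x in Hlen.
  assert (E1 : 1 - eqn (letter_count 1 x x) (letter_count 0 x x) = 0 <-> height w = 0%Z).
  { rewrite (height_letter_count w x Hlen). fold x. unfold eqn.
    destruct (Nat.eqb_spec (letter_count 1 x x) (letter_count 0 x x)); lia. }
  assert (E2 : bsum (Datatypes.S x) (fun i => par (count_at x i 0) + par (count_at x 0 i)) = 0
    <-> forall i, lamps_count w i = false).
  { rewrite bsum_eq0. split.
    - intros H i. destruct (Z_lt_le_dec (Z.of_nat x) (Z.abs i)) as [L|L];
        [apply lamps_count_far; lia|].
      specialize (H (Z.abs_nat i) ltac:(lia)). apply Nat.eq_add_0 in H.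
      rewrite !par_eq0 in H. unfold x in H. rewrite !odd_count_at in H.
      destruct H as [H1 H2]. destruct (Z.le_ge_cases 0 i) as [Hi|Hi].
      + rewrite <- H1. f_equal. lia.
      + rewrite <- H2. f_equal. lia.
    - intros H k _. apply Nat.eq_add_0. rewrite !par_eq0. unfold x.
      rewrite !odd_count_at. split; apply H. }
  assert (E3 : bsum x (fun p => chi (Datatypes.S p) * par (pair_count x (Datatypes.S p))) = 0
    <-> forall p : nat, 0 < p -> ~ S p -> lamps_pairs w (Z.of_nat p) = false).
  { rewrite bsum_eq0. split.
    - intros H p Hp Sp. destruct (le_lt_dec p x) as [L|L];
        [|apply lamps_pairs_far; lia].
      specialize (H (pred p) ltac:(lia)). rewrite Nat.succ_pred in H by lia.
      rewrite (proj2 (Hchi p) Sp), Nat.mul_1_l, par_eq0 in H.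
      unfold x in H. rewrite odd_pair_count in H. exact H.
    - intros H p _. destruct (classic (S (Datatypes.S p))) as [Sp|Sp].
      + rewrite (proj1 (Hchi _) Sp). reflexivity.
      + rewrite (proj2 (par_eq0 _)); [apply Nat.mul_0_r|]. unfold x.
        rewrite odd_pair_count. apply H; [lia|exact Sp]. }
  unfold defect, lamp_subgroup. rewrite !Nat.eq_add_0. tauto.
Qed.

Lemma recursive_lamp_subgroup n (S : nat -> Prop) M :
  (forall p, M <= p -> ~ S p) -> recursive_subset n (lamp_subgroup n S).
Proof.
  intros HS. destruct (computable_finite_set S M HS) as [chi [Hc Hchi]].
  (* Truncated subtraction turns a zero defect into the answer 1 and any other into 0. *)
  assert (H : computable 1 (fun e => 1 - defect chi (nth 0 e 0))).
  { apply computable_sub; [apply computable_const|apply computable_defect, Hc]. }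
  destruct H as [c H]. exists c. intros w Hw.
  destruct (H [encode_word w] eq_refl) as [K HK]. cbn [nth] in HK.
  pose proof (defect_eq0 n S chi w Hchi Hw) as E.
  split; intros HN; exists K; rewrite HK by lia; f_equal.
  - apply E in HN. rewrite HN. reflexivity.
  - assert (defect chi (encode_word w) <> 0) by tauto. lia.
Qed.

(** * Codes of partial recursive functions *)

Lemma omap_all_mono {A B : Type} (h h' : A -> option B) l v :
  (forall a b, h a = Some b -> h' a = Some b) ->
  omap_all h l = Some v -> omap_all h' l = Some v.
Proof.
  intros H. revert v. induction l as [|a l IH]; simpl; intros v E; [exact E|].
  destruct (h a) as [b|] eqn:Ea; [|discriminate].
  destruct (omap_all h l) as [bs|]; [|discriminate].
  rewrite (H _ _ Ea), (IH bs eq_refl). exact E.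
Qed.

(** Besides the induction on fuel, [CPrec] needs one on the recursion argument and [CMu] one on the
    length of the search. *)
Lemma eval_succ k c args v : eval k c args = Some v -> eval (S k) c args = Some v.
Proof.
  revert c args v. induction k as [|k IH]; intros c args v E; [discriminate|].
  destruct c as [| |i|f gs|f g|f]; try exact E.
  - cbn in E. change (match omap_all (fun g => eval (S k) g args) gs with
      | Some vs => eval (S k) f vs | None => None end = Some v).
    destruct (omap_all (fun g => eval k g args) gs) as [vs|] eqn:Eg; [|discriminate].
    rewrite (omap_all_mono _ (fun g => eval (S k) g args) _ _
      (fun g b => IH g args b) Eg).
    apply IH, E.
  - destruct args as [|x rest]; [discriminate|].
    revert v E. induction x as [|m IHm]; intros v E; [apply IH, E|].
    cbn in E.
    match type of E with match ?r with _ => _ end = _ => destruct r as [r0|] eqn:Er end;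
      [|discriminate].
    specialize (IHm r0 Er). change (match eval (S (S k)) (CPrec f g) (m :: rest) with
      | Some r => eval (S k) g (m :: r :: rest) | None => None end = Some v).
    rewrite IHm. apply IH, E.
  - set (search := fun (k' : nat) => fix search (b y : nat) : option nat :=
      match b with
      | O => None
      | S b' => match eval k' f (y :: args) with
                | Some O => Some y | Some _ => search b' (S y) | None => None end
      end).
    change (search k k 0 = Some v) in E. change (search (S k) (S k) 0 = Some v).
    (* Fuel also bounds the number of search steps, so both this bound and the fuel of the tests
       must be allowed to grow. *)
    enough (H : forall b b' y, b <= b' -> search k b y = Some v ->
      search (S k) b' y = Some v) by (apply (H k); [lia|exact E]).
    clear E. induction b as [|b IHb]; intros [|b'] y Hb E; try discriminate; [lia|].
    change (match eval k f (y :: args) with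
      | Some O => Some y | Some _ => search k b (S y) | None => None end = Some v) in E.
    change (match eval (S k) f (y :: args) with
      | Some O => Some y | Some _ => search (S k) b' (S y) | None => None end = Some v).
    destruct (eval k f (y :: args)) as [u|] eqn:Eu; [|discriminate].
    rewrite (IH _ _ _ Eu). destruct u; [exact E|]. apply IHb; [lia|exact E].
Qed.

Lemma eval_mono k k' c args v :
  k <= k' -> eval k c args = Some v -> eval k' c args = Some v.
Proof. induction 1; intros; [assumption|]. apply eval_succ. auto. Qed.

Lemma halts_with_functional c x u v : halts_with c x u -> halts_with c x v -> u = v.
Proof.
  intros [k Hk] [l Hl].
  apply (eval_mono k (k + l)) in Hk; [|lia].
  apply (eval_mono l (k + l)) in Hl; [|lia]. congruence.
Qed.

Fixpoint code_index (c : code) : nat :=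
  match c with
  | CZero => cantor_pair 0 0
  | CSucc => cantor_pair 1 0
  | CProj i => cantor_pair 2 i
  | CComp f gs => cantor_pair 3 (cantor_pair (code_index f)
      (fold_right (fun g r => S (cantor_pair (code_index g) r)) 0 gs))
  | CPrec f g => cantor_pair 4 (cantor_pair (code_index f) (code_index g))
  | CMu f => cantor_pair 5 (code_index f)
  end.

(** Codes nest through lists of codes, hence an explicit fixpoint with an inner one along the list
    of arguments of [CComp]. *)
Lemma code_index_inj c d : code_index c = code_index d -> c = d.
Proof.
  revert c d. fix IH 1.
  intros [| |i|f gs|f g|f] [| |j|f' gs'|f' g'|f'] E; cbn [code_index fold_right] in E;
    apply cantor_pair_inj in E; destruct E as [E1 E]; try discriminate E1.
  - reflexivity.
  - reflexivity.
  - congruence.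
  - apply cantor_pair_inj in E. destruct E as [Ef Eg].
    f_equal; [exact (IH f f' Ef)|].
    revert gs gs' Eg. fix IHl 1. intros [|g gs] [|g' gs'] Eg;
      [reflexivity|discriminate Eg|discriminate Eg|].
    apply eq_add_S, cantor_pair_inj in Eg. destruct Eg as [E2 E3].
    f_equal; [exact (IH g g' E2)|exact (IHl gs gs' E3)].
  - apply cantor_pair_inj in E. destruct E as [Ef Eg].
    f_equal; [exact (IH f f' Ef)|exact (IH g g' Eg)].
  - f_equal. exact (IH f f' E).
Qed.

(** * The upper bound: membership in the class of countable unions of closed sets *)

Definition decides (n : nat) (c : code) (N : word -> Prop) : Prop :=
  forall w, in_Fn n w ->
    (N w -> halts_with c (encode_word w) 1) /\ (~ N w -> halts_with c (encode_word w) 0).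

(** The subgroups decided by a fixed code form a closed set: a failure shows at a single word, and
    persists as long as membership of that word is unchanged. There are countably many codes. *)
Lemma Sigma02_recursive n :
  Sigma02 (Gn n) (Gn_open n) (fun N => Gn n N /\ recursive_subset n N).
Proof.
  exists (fun k N => Gn n N /\ exists c, code_index c = k /\ decides n c N). split.
  - intros k. split; [tauto|]. intros N HN [_ Hno].
    destruct (classic (exists c, code_index c = k)) as [[c Hc]|Hk].
    + assert (exists w, in_Fn n w /\ ~ ((N w -> halts_with c (encode_word w) 1) /\
        (~ N w -> halts_with c (encode_word w) 0))) as (w & Hw & Hbad).
      { apply NNPP. intros H. apply Hno. split; [exact HN|].
        exists c. split; [exact Hc|]. intros w Hw. apply NNPP. intros Hbad.
        apply H. exists w. split; assumption. }
      exists [w]. intros N' HN' Hag. split; [exact HN'|].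
      intros [_ (c' & Hc' & Hdec)].
      assert (c' = c) as -> by (apply code_index_inj; congruence).
      apply Hbad. specialize (Hdec w Hw). specialize (Hag w (or_introl eq_refl)). tauto.
    (* No code has index [k], so the k-th closed set is empty. *)
    + exists []. intros N' HN' _. split; [exact HN'|].
      intros [_ (c & Hc & _)]. apply Hk. exists c. exact Hc.
  - intros N. split.
    + intros [HN [c Hc]]. exists (code_index c). split; [exact HN|].
      exists c. split; [reflexivity|exact Hc].
    + intros (k & HN & c & _ & Hc). split; [exact HN|]. exists c. exact Hc.
Qed.

(** * Zero-dimensional spaces *)

Definition locally_constant {Y A : Type} (d : Y -> Y -> R) (f : Y -> A) : Prop :=
  forall y, exists eps, (0 < eps)%R /\ forall z, (d y z < eps)%R -> f z = f y.

Definition clopen {Y : Type} (d : Y -> Y -> R) (U : Y -> Prop) : Prop :=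
  forall y, exists eps, (0 < eps)%R /\ forall z, (d y z < eps)%R -> (U z <-> U y).

Lemma choice {A B : Type} (P : A -> B -> Prop) :
  (forall x, exists y, P x y) -> exists f : A -> B, forall x, P x (f x).
Proof.
  apply constructive_indefinite_descr_fun_choice.
  exact constructive_indefinite_description.
Qed.

Lemma clopen_of_open {Y : Type} (d : Y -> Y -> R) U :
  metric_open d U -> metric_open d (fun y => ~ U y) -> clopen d U.
Proof.
  intros H1 H2 y. destruct (classic (U y)) as [Hy|Hy].
  - destruct (H1 y Hy) as (eps & He & H). exists eps. split; [exact He|].
    intros z Hz. specialize (H z Hz). tauto.
  - destruct (H2 y Hy) as (eps & He & H). exists eps. split; [exact He|].
    intros z Hz. specialize (H z Hz). simpl in H. tauto.
Qed.

Lemma clopen_finite_inter {Y I : Type} (d : Y -> Y -> R) (P : I -> Y -> Prop) l :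
  (forall i, clopen d (P i)) ->
  forall y, exists eps, (0 < eps)%R /\
    forall z, (d y z < eps)%R -> forall i, In i l -> (P i z <-> P i y).
Proof.
  intros H y. induction l as [|i l (e1 & He1 & H1)].
  - exists 1%R. split; [lra|]. intros z _ i [].
  - destruct (H i y) as (e2 & He2 & H2). exists (Rmin e1 e2).
    split; [apply Rmin_glb_lt; assumption|].
    intros z Hz j [<-|Hj].
    + apply H2. eapply Rlt_le_trans; [exact Hz|apply Rmin_r].
    + apply H1; [|exact Hj]. eapply Rlt_le_trans; [exact Hz|apply Rmin_l].
Qed.

(* For each point of a countable dense set and each radius 1/(b+1), pick one clopen
   subset of U that contains the ball, if there is one. *)
Lemma open_clopen_union {Y : Type} (d : Y -> Y -> R) (D : nat -> Y) U :
  is_metric d -> metric_zero_dim d ->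
  (forall x eps, (0 < eps)%R -> exists k, (d x (D k) < eps)%R) ->
  metric_open d U ->
  exists W : nat * nat -> Y -> Prop,
    (forall i, clopen d (W i)) /\ forall y, U y <-> exists i, W i y.
Proof.
  intros (_ & _ & Hsym & Htri) Hz HD HU.
  set (good := fun (i : nat * nat) (V : Y -> Prop) =>
    forall y, (d (D (fst i)) y < / INR (S (snd i)))%R -> V y).
  assert (HW : forall i, exists V, clopen d V /\ (forall y, V y -> U y) /\
    ((exists V', clopen d V' /\ (forall y, V' y -> U y) /\ good i V') -> good i V)).
  { intros i. destruct (classic (exists V', clopen d V' /\ (forall y, V' y -> U y) /\
      good i V')) as [(V & H1 & H2 & H3)|H].
    - exists V. tauto.
    - exists (fun _ => False). split; [|tauto].
      intros y. exists 1%R. split; [lra|tauto]. }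
  apply choice in HW. destruct HW as [W HW]. exists W.
  split; [intros i; apply HW|]. intros y. split; [|intros [i Hi]; apply (HW i), Hi].
  intros Hy. destruct (HU y Hy) as (e & He & HeU).
  destruct (Hz y e He) as (V & HV1 & HV2 & HVy & HVe).
  destruct (HV1 y HVy) as (r & Hr & HrV).
  (* A dense point within 1/N < r/2 of [y] has its ball of radius 1/N inside the ball of radius r
     about [y], hence inside [V]. The index is [pred N] since index b stands for radius 1/(b+1). *)
  destruct (archimed_cor1 (r / 2) ltac:(lra)) as (N & HN & HN0).
  destruct (HD y (/ INR N)%R) as [k Hk].
  { apply Rinv_0_lt_compat, lt_0_INR, HN0. }
  exists (k, pred N).
  assert (Hgood : good (k, pred N) (W (k, pred N))).
  { apply (HW (k, pred N)). exists V. split; [apply clopen_of_open; assumption|].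
    split; [intros z Hz'; apply HeU, HVe, Hz'|].
    intros z Hdz. simpl in Hdz. apply HrV.
    change (match pred N with 0 => 1 | S _ => INR (pred N) + 1 end)%R
      with (INR (S (pred N))) in Hdz.
    rewrite Nat.succ_pred in Hdz by lia.
    pose proof (Htri y (D k) z). lra. }
  apply Hgood. simpl fst. simpl snd. rewrite Nat.succ_pred by lia.
  rewrite Hsym. exact Hk.
Qed.

(** * Reduction of countable unions of closed sets *)

Section Reduction.
Variables (Y : Type) (d : Y -> Y -> R) (W : nat -> nat * nat -> Y -> Prop).
Hypothesis W_clopen : forall k i, clopen d (W k i).

(** Only finitely many sets are inspected at stage [s], which keeps the condition clopen; a point of
    some [W k i] is nevertheless hit at all large stages. *)
Definition hit (k s : nat) (y : Y) : Prop :=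
  exists i, In i (list_prod (seq 0 s) (seq 0 s)) /\ W k i y.

(* A point is in the union of the closed sets, the k-th of which is the complement of
   the union of the [W k i], iff it has finitely many hits. *)
Fixpoint target (y : Y) (s : nat) : nat :=
  match s with
  | 0 => 0
  | S s' => if excluded_middle_informative (hit (target y s') s' y)
            then S (target y s') else target y s'
  end.

Lemma hit_clopen k s : clopen d (hit k s).
Proof.
  intros y.
  destruct (clopen_finite_inter d (W k) (list_prod (seq 0 s) (seq 0 s)) (W_clopen k) y)
    as (eps & He & H).
  exists eps. split; [exact He|]. intros z Hz.
  split; intros (i & Hi & Hw); exists i; (split; [exact Hi|]); apply (H z Hz i Hi), Hw.
Qed.

Lemma target_locally_constant s : locally_constant d (fun y => target y s).
Proof.
  induction s as [|s IH]; intros y.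
  - exists 1%R. split; [lra|reflexivity].
  - destruct (IH y) as (e1 & He1 & H1).
    destruct (hit_clopen (target y s) s y) as (e2 & He2 & H2).
    exists (Rmin e1 e2). split; [apply Rmin_glb_lt; assumption|].
    intros z Hz. simpl.
    rewrite H1 by (eapply Rlt_le_trans; [exact Hz|apply Rmin_l]).
    specialize (H2 z ltac:(eapply Rlt_le_trans; [exact Hz|apply Rmin_r])).
    destruct (excluded_middle_informative (hit (target y s) s z)),
      (excluded_middle_informative (hit (target y s) s y)); tauto.
Qed.

(** At the first hit from stage [s] on, the pointer has not yet moved away from its value at [s]. *)
Lemma hit_target_between y s m :
  hit (target y (m + s)) (m + s) y ->
  exists t, target y t = target y s /\ hit (target y t) t y.
Proof.
  revert s. induction m as [|m IH]; intros s H; [exists s; split; [reflexivity|exact H]|].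
  destruct (excluded_middle_informative (hit (target y s) s y)) as [Hs|Hs];
    [exists s; split; [reflexivity|exact Hs]|].
  assert (E : target y (S s) = target y s)
    by (simpl; destruct excluded_middle_informative; [contradiction|reflexivity]).
  rewrite <- E. apply IH. rewrite Nat.add_succ_r. exact H.
Qed.

(** The pointer advances by one at each hit, so with infinitely many hits it passes through every
    value, and leaves it by a hit. *)
Lemma target_onto y :
  (forall s, exists m, hit (target y (m + s)) (m + s) y) ->
  forall k, exists s, target y s = k /\ hit k s y.
Proof.
  intros H k. enough (E : exists s, target y s = k).
  { destruct E as [s <-]. destruct (H s) as [m Hm].
    destruct (hit_target_between y s m Hm) as (t & Ht & Hh).
    exists t. split; [exact Ht|]. rewrite <- Ht. exact Hh. }
  induction k as [|k [s <-]]; [exists 0; reflexivity|].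
  destruct (H s) as [m Hm]. destruct (hit_target_between y s m Hm) as (t & Ht & Hh).
  exists (S t). simpl. destruct excluded_middle_informative; [|contradiction].
  congruence.
Qed.

Lemma target_unbounded_iff y :
  (forall s, exists m, hit (target y (m + s)) (m + s) y) <-> forall k, exists i, W k i y.
Proof.
  split; intros H.
  - intros k. destruct (target_onto y H k) as (s & _ & i & _ & Hi). exists i. exact Hi.
  - intros s. destruct (H (target y s)) as [[a b] Hi]. apply NNPP. intros Hno.
    assert (E : forall m, target y (m + s) = target y s).
    { induction m as [|m IH]; [reflexivity|]. simpl.
      destruct excluded_middle_informative as [Hh|_]; [|exact IH].
      destruct Hno. exists m. exact Hh. }
    (* Without further hits the pointer stays at [target y s], but a stage beyond both [a] and [b]
       inspects the pair [(a, b)] and hits. *)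
    apply Hno. exists (S (a + b)). rewrite E. exists (a, b). split; [|exact Hi].
    apply in_prod_iff. rewrite !in_seq. lia.
Qed.

(* A hit at stage s diagonalises, on the witness s + 1, against the code whose index
   is the number of earlier hits. *)
Definition diagonal (y : Y) (p : nat) : Prop :=
  match p with
  | 0 => False
  | S s => hit (target y s) s y /\
      forall c, code_index c = target y s ->
        ~ halts_with c (encode_word (witness (S s))) 1
  end.

(** The halting clause depends on [y] only through the locally constant [target y s]; the reduction
    has to be continuous, not computable. *)
Lemma diagonal_clopen p : clopen d (fun y => diagonal y p).
Proof.
  intros y. destruct p as [|s]; [exists 1%R; split; [lra|tauto]|].
  destruct (target_locally_constant s y) as (e1 & He1 & H1).
  destruct (hit_clopen (target y s) s y) as (e2 & He2 & H2).
  exists (Rmin e1 e2). split; [apply Rmin_glb_lt; assumption|].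
  intros z Hz. simpl.
  rewrite H1 by (eapply Rlt_le_trans; [exact Hz|apply Rmin_l]).
  specialize (H2 z ltac:(eapply Rlt_le_trans; [exact Hz|apply Rmin_r])). tauto.
Qed.

(** With infinitely many hits, each code is met by the pointer at a hit and errs on the witness of
    that stage. With finitely many, the diagonal set is finite. *)
Lemma recursive_diagonal_iff n y : 1 < n ->
  (recursive_subset n (lamp_subgroup n (diagonal y)) <-> ~ forall k, exists i, W k i y).
Proof.
  intros Hn. rewrite <- target_unbounded_iff. split.
  - intros [c Hc] H. destruct (target_onto y H (code_index c)) as (s & Es & Hs).
    pose proof (lamp_subgroup_witness n (diagonal y) (S s) Hn (Nat.lt_0_succ s)) as Hw.
    destruct (Hc (witness (S s)) (in_Fn_witness n (S s) Hn)) as [H1 H0].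
    destruct (classic (diagonal y (S s))) as [HS|HS].
    + apply (proj2 HS c (eq_sym Es)). apply H1, Hw, HS.
    (* If the witness is left out, [c] answers 0 and hence not 1; but then the diagonal rule would
       have put it in. *)
    + assert (H0' : halts_with c (encode_word (witness (S s))) 0) by (apply H0; tauto).
      apply HS. simpl. rewrite Es. split; [exact Hs|].
      intros c' Ec H1'. apply code_index_inj in Ec. subst c'.
      discriminate (halts_with_functional _ _ _ _ H0' H1').
  - intros H. apply not_all_ex_not in H. destruct H as [s0 Hs0].
    (* There is no hit from stage [s0] on, and stage s concerns the integer s + 1. *)
    apply recursive_lamp_subgroup with (M := S s0).
    intros [|s] Hs; simpl; [tauto|]. intros [Hh _]. apply Hs0.
    exists (s - s0). replace (s - s0 + s0) with s by lia. exact Hh.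
Qed.

End Reduction.

(** * Continuity of the reduction and completeness *)

Lemma lamp_subgroup_ext n S S' w :
  (forall p, p <= length w -> (S p <-> S' p)) ->
  lamp_subgroup n S w -> lamp_subgroup n S' w.
Proof.
  intros H (H1 & H2 & H3 & H4). repeat split; try apply H1; auto.
  intros p Hp Sp. destruct (le_lt_dec p (length w)) as [L|L];
    [|apply lamps_pairs_far; lia].
  apply H4; [exact Hp|]. rewrite H by exact L. exact Sp.
Qed.

(** A basic open set fixes finitely many words, whose membership depends on finitely many clopen
    conditions; the sum of the lengths bounds all the integers involved. *)
Lemma continuous_lamp_subgroup {Y : Type} (d : Y -> Y -> R) n (X : Y -> nat -> Prop) :
  (forall p, clopen d (fun y => X y p)) ->
  continuous_between (fun _ => True) (metric_open d) (Gn n) (Gn_open n)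
    (fun y => lamp_subgroup n (X y)).
Proof.
  intros HX. split; [intros y _; apply lamp_subgroup_normal|].
  intros U HU y [_ Hy].
  destruct (HU _ (lamp_subgroup_normal n (X y)) Hy) as [l Hl].
  destruct (clopen_finite_inter d (fun p y => X y p)
    (seq 0 (S (list_sum (map (@length letter) l)))) HX y) as (eps & He & H).
  exists eps. split; [exact He|]. intros z Hz. split; [exact I|].
  apply Hl; [apply lamp_subgroup_normal|]. intros w Hw.
  assert (Hlen : length w <= list_sum (map (@length letter) l)).
  { clear - Hw. induction l as [|v l IH]; [destruct Hw|].
    change (length w <= length v + list_sum (map (@length letter) l)).
    destruct Hw as [->|Hw]; [lia|]. specialize (IH Hw). lia. }
  assert (E : forall p, p <= length w -> (X z p <-> X y p)).
  { intros p Hp. apply (H z Hz). apply in_seq. lia. }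
  split; apply lamp_subgroup_ext; intros p Hp; specialize (E p Hp); tauto.
Qed.

Theorem mainTheorem5 (n : nat) (hn : (1 < n)%nat) :
  Sigma02_complete_in_Gn n
    (fun N => Gn n N /\ recursive_subset n N).
Proof.
  split; [tauto|]. split; [apply Sigma02_recursive|].
  intros Y d (Hm & _ & Hsep & Hz) B (F & HF & HB).
  destruct Hsep as [Hempty|[D HD]].
  (* On the empty space any map will do. *)
  { exists (fun _ _ => False). split; [split; [|intros U _]|]; intros y; destruct (Hempty y). }
  (* The complement of each [F k] is open, hence a countable union of clopen sets. *)
  assert (HW : forall k, exists W : nat * nat -> Y -> Prop,
    (forall i, clopen d (W i)) /\ forall y, True /\ ~ F k y <-> exists i, W i y).
  { intros k. apply (open_clopen_union d D); try assumption. apply HF. }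
  apply choice in HW. destruct HW as [W HW].
  assert (HWc : forall k i, clopen d (W k i)) by (intros k; apply HW).
  exists (fun y => lamp_subgroup n (diagonal Y W y)). split.
  - apply continuous_lamp_subgroup. intros p. apply diagonal_clopen, HWc.
  - intros y.
    (* All the unions of the [W k i] contain [y] exactly when [y] is outside every [F k], that is,
       outside [B]. *)
    assert (E : (forall k, exists i, W k i y) <-> forall k, ~ F k y).
    { split; intros H k; specialize (H k); apply (HW k) in H || apply (HW k); tauto. }
    rewrite (recursive_diagonal_iff Y W n y hn), E, HB.
    split.
    + intros [_ H]. apply not_all_not_ex, H.
    + intros [k Hk]. split; [apply lamp_subgroup_normal|]. intros H. exact (H k Hk).
Qed.
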